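(* Let $n$ be a positive integer. The set of all ordered multiplicity lists attained by matrices in $\mathcal{S}_L(K_n)$ is exactly the set of lists $(m_1, \ldots, m_q)$ of positive integers (of any length $q$) with $m_1 = 1$ and $m_1 + \cdots + m_q = n$.
   Context: Graphs are finite and simple; $K_n$ is the complete graph on $n$ vertices. For a graph $G$ on $n$ vertices, $\mathcal{S}_L(G)$ denotes the set of $n\times n$ real symmetric matrices $A=[a_{i,j}]$ such that $a_{i,j}<0$ if $\{i,j\}\in E(G)$, $a_{i,j}=0$ if $i\neq j$ and $\{i,j\}\notin E(G)$, and $a_{i,i}=-\sum_{k\neq i}a_{i,k}$ for all $i$. The ordered multiplicity list of $A\in\mathcal{S}_L(G)$ is $(m_1,\ldots,m_q)$, where $\lambda_1<\lambda_2<\cdots<\lambda_q$ are the distinct eigenvalues of $A$ in increasing order and $m_i$ is the multiplicity of $\lambda_i$. *)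

(* Defs.v *)
From HB Require Import structures.
From mathcomp Require Import all_boot all_order all_algebra.
From mathcomp Require Import classical_sets reals.

Set Implicit Arguments.
Unset Strict Implicit.
Unset Printing Implicit Defensive.

Import Order.TTheory GRing.Theory Num.Theory.
Local Open Scope ring_scope.
Local Open Scope classical_set_scope.

Record sgraph (n : nat) := SGraph {
  edge : rel 'I_n;
  edge_sym : symmetric edge;
  edge_irr : irreflexive edge }.

Lemma complete_sym (n : nat) : symmetric (fun i j : 'I_n => i != j).
Proof. by move=> i j; rewrite eq_sym. Qed.

Lemma complete_irr (n : nat) : irreflexive (fun i j : 'I_n => i != j).
Proof. by move=> i; rewrite eqxx. Qed.

Definition complete_graph (n : nat) : sgraph n :=
  SGraph (@complete_sym n) (@complete_irr n).

Definition SL (R : realType) (n : nat) (G : sgraph n) : set 'M[R]_n :=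
  [set A | [/\ A^T = A,
               forall i j, edge G i j -> A i j < 0,
               forall i j, i != j -> ~~ edge G i j -> A i j = 0
             & forall i, A i i = - \sum_(k < n | k != i) A i k]].

(* The witness s is unique: it lists the distinct eigenvalues in increasing
   order.  Multiplicities are algebraic; for symmetric real matrices they agree
   with the geometric ones. *)
Definition ordered_multiplicity_list
    (R : realType) (n : nat) (A : 'M[R]_n) (m : seq nat) : Prop :=
  exists s : seq R,
    [/\ sorted <%R s,
        forall a, (a \in s) = eigenvalue A a
      & m = [seq mup a (char_poly A) | a <- s]].

(* Main.v *)
Require Import Defs.
From HB Require Import structures.
From mathcomp Require Import all_boot all_order all_algebra.
From mathcomp Require Import classical_sets reals.
From mathcomp Require Import complex.

Set Implicit Arguments.
Unset Strict Implicit.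
Unset Printing Implicit Defensive.

Import Order.TTheory GRing.Theory Num.Theory.
Local Open Scope ring_scope.
Local Open Scope classical_set_scope.

(** Write a weighted Laplacian of the complete graph on [1 + n] vertices in the
    basis formed by the first unit row vector [e_0] and the differences
    [e_k - e_0].  Because the rows of the matrix sum to zero, it becomes block
    upper triangular with blocks [0] and [deflation A], so that its
    characteristic polynomial is ['X] times that of the deflation
    ([char_poly_deflation]).  Both inclusions rest on this factorisation.

    Necessity.  A real symmetric matrix has a characteristic polynomial that
    splits ([sym_char_poly_split]), hence the multiplicities are positive and
    sum to the size.  A maximum principle controls the bottom of the spectrum:
    at a largest entry of [v], every term [(v_j - v_i) A_ji] of [(v A)_i] is
    nonnegative.  Therefore no eigenvalue is negative
    ([eigenvalue_zero_col_sum_ge0]), and a vector of the kernel is constant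
    ([kernel_const]).  A null vector of the deflation would give a kernel vector
    of [A] whose entries sum to zero; being constant, it vanishes.  So [0] is
    the least eigenvalue, and it is simple ([deflation_nonsingular]).

    Sufficiency.  Add vertices one at a time, joining each new vertex to all the
    earlier ones by edges of one common weight.  The edge between [i] and [j]
    then has a weight depending only on [maxn i j], the deflation is lower
    triangular, and the nonzero eigenvalues can be read on its diagonal: each is
    an affine function of one weight and of the later ones.  Solving for the
    weights from the last vertex backwards, they come out positive as soon as
    the prescribed positive eigenvalues are listed in nonincreasing order
    ([join_weights]).  Hence every positive list is the nonzero spectrum of some
    matrix ([SL_char_poly_prescribed]), and the eigenvalues [1], [2], ... may be
    repeated as many times as the multiplicity list requires. *)

(** * Characteristic polynomials *)

Lemma char_poly_similar (R : idomainType) n (A B P : 'M[R]_n) :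
  \det P != 0 -> P *m A = B *m P -> char_poly A = char_poly B.
Proof.
move=> P0 PA; pose Q := map_mx polyC P.
have Q0 : \det Q != 0 by rewrite det_map_mx polyC_eq0.
apply: (mulfI Q0); rewrite [RHS]mulrC -!det_mulmx; congr (\det _).
by rewrite mulmxBr mulmxBl -!map_mxM PA scalar_mxC.
Qed.

(** Over the complex numbers [A] is Hermitian, hence diagonalisable with a real
    diagonal; the factorisation descends because the embedding of the base field
    is injective on polynomials. *)
Lemma sym_char_poly_split (R : rcfType) n (A : 'M[R]_n) : A^T = A ->
  exists L : seq R, char_poly A = \prod_(x <- L) ('X - x%:P).
Proof.
move=> symA; pose toC := real_complex R; pose B : 'M[R[i]]_n := map_mx toC A.
have hB : B \is hermsymmx.
  apply/is_hermitianmxP; rewrite expr0 scale1r.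
  apply/matrixP=> i j; rewrite !mxE -{1}symA mxE.
  by apply/esym/CrealP; rewrite complex_real.
have /orthomx_spectralP EB := hermitian_normalmx hB.
have rB := hermitian_spectral_diag_real hB.
move: (spectral_unit B) EB rB.
move: (spectralmx B) (spectral_diag B) => P d uP EB rB.
exists [seq complex.Re (d 0 i) | i <- enum 'I_n].
apply: (@map_poly_inj _ _ (real_complex R)).
rewrite map_char_poly (@char_poly_similar _ _ _ (diag_mx d) P); last 2 first.
- by move: uP; rewrite unitmxE unitfE.
- by rewrite [map_mx _ _]EB !mulmxA mulmxV // mul1mx.
rewrite char_poly_trig ?diag_mx_is_trig // rmorph_prod big_map big_enum /=.
apply: eq_bigr => i _; rewrite rmorphB /= map_polyX map_polyC /= mxE eqxx.
by rewrite RRe_real //; exact: (mxOverP rB).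
Qed.

(** When the rows of [A] sum to zero, this is the matrix of [v |-> v *m A] on
    the row vectors of sum zero, in the basis of the differences [e_k - e_0]. *)
Definition deflation (R : pzRingType) n (A : 'M[R]_(1 + n)) : 'M[R]_n :=
  drsubmx A - const_mx 1 *m ursubmx A.

Lemma deflationE (R : pzRingType) n (A : 'M[R]_(1 + n)) i j :
  deflation A i j = A (rshift 1 i) (rshift 1 j) - A 0 (rshift 1 j).
Proof.
rewrite !mxE big_ord1 !mxE mul1r; congr (A _ _ - A _ _).
by apply/val_inj.
Qed.

(** The row vectors of sum zero form an invariant subspace that contains the
    whole image of [A], so [A] acts on the quotient line by [0]. *)
Lemma char_poly_deflation (R : idomainType) n (A : 'M[R]_(1 + n)) :
  A *m const_mx 1 = 0 :> 'cV_(1 + n) ->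
  char_poly A = 'X * char_poly (deflation A).
Proof.
rewrite -{1}[A]submxK -col_mx_const mul_block_col -[RHS]vsubmxK linear0 linear0.
move=> /eq_col_mx[/eqP + /eqP]; rewrite !addr_eq0 => /eqP EA0 /eqP EA1.
(* The rows of [P] are [e_0] and the differences [e_k - e_0]. *)
pose P : 'M[R]_(1 + n) := block_mx 1%:M 0 (- const_mx 1) 1%:M.
pose B : 'M[R]_(1 + n) := block_mx 0 (ursubmx A) 0 (deflation A).
have c1 : const_mx 1 = 1%:M :> 'M[R]_1.
  by apply/matrixP=> i j; rewrite !mxE !ord1.
rewrite c1 !mulmx1 in EA0 EA1.
rewrite (@char_poly_similar _ _ A B P).
- rewrite /char_poly /char_poly_mx scalar_mx_block map_block_mx opp_block_mx.
  rewrite add_block_mx !map_mx0 !oppr0 !addr0 det_ublock.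
  by rewrite det_scalar expr1.
- by rewrite det_lblock !det1 mulr1 oner_eq0.
rewrite -{1}[A]submxK !mulmx_block.
rewrite !(mul0mx, mul1mx, mulmx0, mulmx1, add0r, addr0).
rewrite !mulNmx !mulmxN; congr (block_mx _ _ _ _) => //.
  by rewrite addrC EA0 EA1 mulmxN opprK /deflation mulmxBl mulmxA opprB addrC.
by rewrite addrC.
Qed.

(** * The maximum principle *)

(** Since column [i] sums to zero, [v] may be shifted by the constant [v_i]. *)
Lemma mul_zero_col_sum (R : pzRingType) n (A : 'M[R]_n) (v : 'rV[R]_n) i :
  A i i = - \sum_(k < n | k != i) A k i ->
  (v *m A) 0 i = \sum_(j < n | j != i) (v 0 j - v 0 i) * A j i.
Proof.
move=> col0; rewrite mxE (bigD1 i) //= col0 mulrN mulr_sumr addrC -sumrB.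
by apply: eq_bigr => j _; rewrite mulrBl.
Qed.

Lemma mul_max_term_ge0 (R : realDomainType) n (A : 'M[R]_n) (v : 'rV[R]_n) i :
  (forall i j, i != j -> A i j < 0) -> (forall j, v 0 j <= v 0 i) ->
  forall j, j != i -> 0 <= (v 0 j - v 0 i) * A j i.
Proof. by move=> neg vi j ji; rewrite mulr_le0 ?subr_le0 // ltW ?neg. Qed.

(** At a largest entry of a kernel vector, a sum of nonnegative terms vanishes,
    so each difference with that entry does. *)
Lemma kernel_const (R : realDomainType) n (A : 'M[R]_n) (v : 'rV[R]_n) :
  (forall i, A i i = - \sum_(k < n | k != i) A k i) ->
  (forall i j, i != j -> A i j < 0) ->
  v *m A = 0 -> forall i j, v 0 i = v 0 j.
Proof.
move=> col0 neg vA0 i0 j0.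
have [i _ vi] := @arg_maxP _ _ _ i0 predT (v 0) isT.
suff E j : v 0 j = v 0 i by rewrite !E.
have := mul_zero_col_sum v (col0 i); rewrite vA0 mxE => /esym/eqP.
rewrite psumr_eq0; last by apply: mul_max_term_ge0 => // k; apply: vi.
have [->//|ji] := eqVneq j i.
move=> /allP/(_ j); rewrite mem_index_enum ji => /(_ isT).
by rewrite mulf_eq0 (lt_eqF (neg _ _ ji)) orbF subr_eq0 => /eqP.
Qed.

(** For a negative eigenvalue [a], the largest entry of an eigenvector [u]
    satisfies [0 <= (u A)_i = a u_i], so [u] has no positive entry; the same
    holds for [- u]. *)
Lemma eigenvalue_zero_col_sum_ge0 (R : realFieldType) n (A : 'M[R]_n) a :
  (forall i, A i i = - \sum_(k < n | k != i) A k i) ->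
  (forall i j, i != j -> A i j < 0) -> eigenvalue A a -> 0 <= a.
Proof.
move=> col0 neg /eigenvalueP[v vA v0]; rewrite leNgt; apply/negP => a0.
have pos (u : 'rV[R]_n) j : u *m A = a *: u -> u 0 j <= 0.
  move=> uA; have [i _ ui] := @arg_maxP _ _ _ j predT (u 0) isT.
  have ui' k : u 0 k <= u 0 i by exact: ui.
  apply: le_trans (ui' j) _.
  have : 0 <= (u *m A) 0 i.
    by rewrite mul_zero_col_sum //; apply/sumr_ge0/mul_max_term_ge0.
  by rewrite uA mxE nmulr_rge0.
case/eqP: v0; apply/rowP=> j; rewrite mxE; apply/eqP; rewrite eq_le pos //=.
have := pos (- v) j; rewrite mxE oppr_le0; apply.
by rewrite mulNmx vA scalerN.
Qed.

(** A null vector of the deflation extends to a kernel vector of [A] whose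
    entries sum to zero, and the kernel of [A] consists of constant vectors. *)
Lemma deflation_nonsingular (R : realFieldType) n (A : 'M[R]_(1 + n)) :
  (forall i, A i i = - \sum_(k < 1 + n | k != i) A k i) ->
  (forall i j, i != j -> A i j < 0) -> A *m const_mx 1 = 0 :> 'cV_(1 + n) ->
  ~~ root (char_poly (deflation A)) 0.
Proof.
move=> col0 neg A1; rewrite -eigenvalue_root_char.
apply/eigenvalueP=> -[y]; rewrite scale0r => yT /eqP; apply.
pose v : 'rV[R]_(1 + n) := row_mx (- (y *m const_mx 1)) y.
have vr : rsubmx (v *m A) = 0.
  rewrite -{1}[A]submxK mul_row_block row_mxKr -[RHS]yT /deflation mulmxBr.
  by rewrite mulNmx mulmxA addrC.
(* The entries of [v *m A] sum to zero, so the first one vanishes as well. *)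
have vA : v *m A = 0.
  have : v *m A *m (const_mx 1 : 'cV_(1 + n)) = 0 by rewrite -mulmxA A1 mulmx0.
  rewrite -[v *m A in LHS]hsubmxK vr -col_mx_const mul_row_col mul0mx addr0.
  move=> vl; rewrite -[LHS]hsubmxK vr -[RHS]hsubmxK !linear0; congr row_mx.
  apply/rowP=> i; rewrite !ord1; move/matrixP/(_ 0 0): vl.
  by rewrite !mxE big_ord1 !mxE mulr1.
have vc := kernel_const col0 neg vA.
have yc i : y 0 i = v 0 0 by rewrite (vc 0 (rshift 1 i)) row_mxEr.
have v0 : v 0 0 = 0.
  have : v 0 0 = - \sum_(i < n) v 0 0.
    transitivity (v 0 (lshift n 0)); first by congr (v _ _); apply/val_inj.
    rewrite row_mxEl [LHS]mxE [in LHS]mxE; congr (- _).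
    by apply: eq_bigr => i _; rewrite yc [const_mx _ _ _]mxE mulr1.
  rewrite sumr_const card_ord => /eqP; rewrite -addr_eq0 -mulrS.
  by rewrite mulrn_eq0 => /eqP.
by apply/rowP=> i; rewrite yc v0 mxE.
Qed.

(** * Realising a prescribed spectrum *)

(** The last equation gives [w n.-1 = l n.-1 / n.+1], and this weight occurs
    with coefficient [1] in each of the others: subtracting it from the earlier
    values leaves the same system with one unknown less.  The new right-hand sides are
    still positive, as [l] is nonincreasing and [w n.-1 < l n.-1]. *)
Lemma join_weights (R : realFieldType) n (l : nat -> R) :
  (forall k, (k < n)%N -> 0 < l k) ->
  (forall j k, (j <= k < n)%N -> l k <= l j) ->
  exists2 w : nat -> R, forall k, (k < n)%N -> 0 < w k &
    forall k, (k < n)%N -> k.+2%:R * w k + \sum_(k.+1 <= i < n) w i = l k.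
Proof.
elim: n l => [|n IHn] l l0 lmono; first by exists (fun=> 0).
have ln0 := l0 n (leqnn _); pose c := l n / n.+2%:R.
have c0 : 0 < c by rewrite divr_gt0.
have cl : c < l n by rewrite ltr_pdivrMr ?ltr0n // ltr_pMr // ltr1n.
have [k kn|j k /andP[jk kn]|w w0 wE] := IHn (fun k => l k - c).
- by rewrite subr_gt0 (lt_le_trans cl) // lmono // ltnW //=.
- by rewrite lerD2r lmono // jk ltnW.
exists (fun k => if k == n then c else w k) => [k|k].
  by rewrite ltnS leq_eqVlt; case: eqP => //= _; apply: w0.
rewrite ltnS leq_eqVlt; have [-> _|kn /= {}kn] := eqVneq k n.
  by rewrite big_geq // addr0 mulrC divfK // pnatr_eq0.
rewrite big_nat_recr //= eqxx addrA; apply/esym/eqP.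
rewrite -subr_eq -wE //; apply/eqP.
congr (_ + _).
by apply: eq_big_nat => i /andP[_ ?]; rewrite ltn_eqF.
Qed.

(** The Laplacian obtained by adding vertices one at a time, vertex [k.+1] being
    joined to all the earlier ones with edges of weight [w k].  No edge has
    [maxn i j = 0], so the predecessor loses nothing. *)
Definition join_laplacian (R : pzRingType) n (w : nat -> R) : 'M[R]_(1 + n) :=
  \matrix_(i, j) if i == j then \sum_(k < 1 + n | k != i) w (maxn i k).-1
                 else - w (maxn i j).-1.

(** Vertex [k.+1] has [k.+1] edges of weight [w k] to the earlier vertices, and
    one edge of weight [w i] to each later vertex [i.+1]. *)
Lemma join_laplacian_diag (R : pzRingType) n (w : nat -> R) (k : 'I_n) :
  \sum_(j < 1 + n | j != rshift 1 k) w (maxn (rshift 1 k) j).-1 =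
  k.+1%:R * w k + \sum_(k.+1 <= i < n) w i.
Proof.
rewrite (eq_bigl (fun j : 'I_(1 + n) => j != k.+1 :> nat)); last first.
  by move=> j; rewrite -val_eqE.
rewrite -(big_mkord (fun j => j != k.+1) (fun j => w (maxn k.+1 j).-1)).
rewrite (@big_cat_nat _ _ _ k.+1) //=; last by rewrite ltnS ltnW.
congr (_ + _).
  rewrite (@congr_big_nat _ _ _ 0 k.+1 0 k.+1 _ xpredT _ (fun=> w k)) //.
  - by rewrite sumr_const_nat subn0 mulr_natl.
  - by move=> i /andP[_ ik]; rewrite ltn_eqF.
  - by move=> i /andP[_ /andP[_ ik]]; rewrite (maxn_idPl (ltnW ik)).
rewrite big_ltn_cond ?ltnS // eqxx /= big_add1 /=.
rewrite [LHS]big_nat_cond [RHS]big_nat_cond.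
apply: eq_big => [i|i /andP[/andP[ki _] _]].
  by case: ltngtP => //= ki; rewrite ?andbT // eqSS gtn_eqF // andbT.
by rewrite (maxn_idPr _) // ltnS ltnW.
Qed.

Lemma SL_join_laplacian (R : realType) n (w : nat -> R) :
  (forall k, (k < n)%N -> 0 < w k) ->
  SL (complete_graph (1 + n)) (join_laplacian n w).
Proof.
move=> w0; split=> [|i j /= ij|i j ij|i].
- apply/matrixP=> i j; rewrite !mxE [j == i]eq_sym maxnC.
  by case: eqVneq => // ->.
- rewrite mxE (negPf ij) oppr_lt0 w0 //.
  rewrite -ltnS prednK; last first.
    move: ij; rewrite leq_max -val_eqE /=.
    by case: (nat_of_ord i) (nat_of_ord j) => [|?] [|?].
  by rewrite gtn_max !ltn_ord.
- by rewrite /= ij.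
- rewrite mxE eqxx -sumrN; apply: eq_bigr => k ki.
  by rewrite mxE eq_sym (negPf ki) opprK.
Qed.

Lemma SL_mul1 (R : realType) n (G : sgraph n) (A : 'M[R]_n) :
  SL G A -> A *m const_mx 1 = 0 :> 'cV_n.
Proof.
case=> _ _ _ rowA; apply/colP=> i; rewrite !mxE (bigD1 i) //= !mxE mulr1 rowA.
under eq_bigr do rewrite mxE mulr1.
exact: addNr.
Qed.

(** The deflation of a join Laplacian is lower triangular, since every vertex
    smaller than [j] is joined to [j] with the same weight. *)
Lemma SL_char_poly_prescribed (R : realType) n (L : seq R) :
  size L = n -> (forall x, x \in L -> 0 < x) ->
  exists2 A : 'M[R]_(1 + n), SL (complete_graph (1 + n)) A &
    char_poly A = \prod_(x <- 0 :: L) ('X - x%:P).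
Proof.
move=> sL L0; pose L' := sort >=%R L; pose l k := nth 0 L' k.
have sL' : size L' = n by rewrite size_sort.
have [k kn|j k /andP[jk kn]|w w0 wE] := @join_weights _ n l.
- by apply: L0; rewrite -(mem_sort >=%R) mem_nth ?sL'.
- have /(sorted_leq_nth ge_trans ge_refl) := sort_sorted (@ge_total _ R) L.
  by apply; rewrite // inE sL' // (leq_ltn_trans jk).
exists (join_laplacian n w); first exact: SL_join_laplacian.
have A1 := SL_mul1 (SL_join_laplacian w0).
rewrite char_poly_deflation // big_cons subr0; congr (_ * _).
rewrite char_poly_trig; last first.
  apply/is_trig_mxP=> i j ij; rewrite deflationE !mxE -!val_eqE /= eqSS.
  rewrite ltn_eqF //=.
  by rewrite (maxn_idPr _) ?subrr // leq_add2l ltnW.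
rewrite -(perm_big _ (permEl (perm_sort >=%R L))) /= -/L'.
rewrite (big_nth 0) sL' big_mkord; apply: eq_bigr => i _.
congr ('X - _%:P); rewrite deflationE !mxE eqxx /= join_laplacian_diag.
(* The entry [A 0 i.+1] subtracted by the deflation supplies the missing copy of
   [w i] that turns the degree of [i.+1] into the eigenvalue. *)
by rewrite opprK -[RHS]wE // -[i.+2]addn1 natrD mulrDl mul1r addrAC.
Qed.

(** * Multiplicity lists *)

Lemma sumn_count (T : eqType) (s L : seq T) :
  uniq s -> s =i L -> sumn [seq count_mem a L | a <- s] = size L.
Proof.
move=> us sL; rewrite -(perm_size (perm_count_undup L)) size_flatten.
have /(perm_map (fun a => count_mem a L))/perm_sumn -> : perm_eq s (undup L).
  by apply: uniq_perm; rewrite ?undup_uniq // => x; rewrite sL mem_undup.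
congr sumn; rewrite /shape -map_comp.
by apply: eq_map => a /=; rewrite size_nseq.
Qed.

Lemma prescribed_counts (T : eqType) (s : seq T) (m : seq nat) :
  uniq s -> size s = size m ->
  exists L, [/\ size L = sumn m, {subset L <= s} &
                [seq count_mem a L | a <- s] = m].
Proof.
elim: s m => [|a s IHs] [|k m] //=; first by exists [::].
move=> /andP[as_ us] [/(IHs _ us)[L [sL Ls cL]]]; exists (nseq k a ++ L); split.
- by rewrite size_cat size_nseq sL.
- move=> x; rewrite mem_cat mem_nseq inE => /orP[/andP[_ ->]//|/Ls->].
  exact: orbT.
rewrite count_cat count_nseq /= eqxx mul1n (count_memPn _) ?addn0; last first.
  by apply: contra as_; apply: Ls.
congr (_ :: _); rewrite -[RHS]cL; apply/eq_in_map => x xs.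
rewrite count_cat count_nseq /= (_ : a == x = false) //.
by apply: contraNF as_ => /eqP->.
Qed.

Theorem theorem3p3 (R : realType) (n : nat) (n_gt0 : (0 < n)%N) :
  [set m : seq nat | exists2 A : 'M[R]_n,
     SL (complete_graph n) A & ordered_multiplicity_list A m] =
  [set m : seq nat | [/\ all (fun k => 0 < k)%N m,
                         nth 0%N m 0 = 1%N & sumn m = n]].
Proof.
case: n n_gt0 => [//|n] _; apply/seteqP; split=> m /=.
- move=> [A SA [s [sort_s sE ->]]]; have [symA neg _ rowA] := SA.
  have col0 i : A i i = - \sum_(k < 1 + n | k != i) A k i.
    by rewrite rowA; congr (- _); apply: eq_bigr => k _; rewrite -{1}symA mxE.
  have A1 := SL_mul1 SA; have EA := char_poly_deflation A1.
  have [L EL] := sym_char_poly_split symA.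
  have mupL a : mup a (char_poly A) = count_mem a L by rewrite EL mu_prod_XsubC.
  have sL : s =i L.
    by move=> a; rewrite sE eigenvalue_root_char EL root_prod_XsubC.
  have us := lt_sorted_uniq sort_s.
  split.
  + rewrite all_map; apply/allP => a /=; rewrite mupL sL => aL.
    by rewrite -has_count has_pred1.
  (* The least eigenvalue is [0], whose multiplicity is that of ['X]. *)
  + have s0 : 0 \in s by rewrite sE eigenvalue_root_char EA rootM rootX eqxx.
    have s_ge0 a : a \in s -> 0 <= a.
      by rewrite sE; apply: eigenvalue_zero_col_sum_ge0.
    case: s s0 s_ge0 sort_s {sE sL us} => [//|b s] s0 s_ge0.
    rewrite /= (path_sortedE lt_trans) => /andP[/allP bs _].
    have -> : b = 0.
      apply/eqP; move: s0; rewrite inE => /orP[/eqP->//|/bs b0].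
      by have := s_ge0 b (mem_head _ _); rewrite leNgt b0.
    rewrite EA mulrC mupMr ?deflation_nonsingular //.
    by rewrite -[X in mup _ X]subr0 -[_ - 0]expr1 (@mup_XsubCX _ 1) eqxx.
  + rewrite (eq_map mupL) sumn_count //; apply: succn_inj.
    by rewrite -(size_prod_XsubC L id) -EL size_char_poly.
- case: m => [[]//|k m] /= [/andP[_ mpos] -> /succn_inj sm].
  pose s : seq R := [seq i.+1%:R | i <- iota 0 (size m)].
  have us : uniq s.
    rewrite map_inj_uniq ?iota_uniq // => i j /eqP.
    by rewrite eqr_nat eqSS => /eqP.
  have [|L [sL Ls cL]] := prescribed_counts us (m := m).
    by rewrite size_map size_iota.
  have s_gt0 x : x \in s -> 0 < x by move=> /mapP[i _ ->]; rewrite ltr0n.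
  have [|x /Ls/s_gt0//|A SA EA] := @SL_char_poly_prescribed R n L.
    by rewrite sL.
  exists A => //; exists (0 :: s); split.
  + rewrite /= (path_sortedE lt_trans) (introT allP s_gt0) /=.
    rewrite sorted_map (sub_sorted _ (iota_ltn_sorted 0 _)) // => i j ij /=.
    by rewrite ltr_nat ltnS.
  + move=> a; rewrite eigenvalue_root_char EA root_prod_XsubC !inE.
    congr (_ || _); apply/idP/idP => [as_|/Ls//].
    rewrite -has_pred1 has_count; move/allP: mpos; apply.
    by rewrite -cL; apply/mapP; exists a.
  + have E a : mup a (char_poly A) = count_mem a (0 :: L).
      by rewrite EA mu_prod_XsubC.
    rewrite (eq_map E) /= eqxx (count_memPn _); last first.
      by apply/negP => /Ls/s_gt0; rewrite ltxx.
    congr (_ :: _); rewrite -[LHS]cL; apply/eq_in_map => a /s_gt0 a0.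
    by rewrite /= lt_eqF.
Qed.
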